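(* Let $n=2$, let $f(x)=\frac12 x^TAx-b^Tx$ with $A\in\mathbb{R}^{2\times 2}$ symmetric positive definite and $b\in\mathbb{R}^2$, and let $\Psi$ be an admissible function for $A$. Let $k_0\ge 2$ be an integer and $r\in\mathbb{R}$. Suppose that the gradient method $x_{k+1}=x_k-\alpha_k g_k$, $g_k=\nabla f(x_k)$, is applied to minimize $f$ with $$\alpha_k=\alpha_k(\Psi(A))=\frac{g_{k-1}^T\Psi(A)g_{k-1}}{g_{k-1}^T\Psi(A)Ag_{k-1}}\quad\text{for all } k\neq k_0,$$ and with the stepsize $$\alpha_{k_0}=\tilde\alpha_{k_0}=\frac{2}{\left(H_{k_0}^{(11)}+H_{k_0}^{(22)}\right)+\sqrt{\left(H_{k_0}^{(11)}-H_{k_0}^{(22)}\right)^2+4\left(H_{k_0}^{(12)}\right)^2}}$$ at the $k_0$-th iteration, where $H_{k_0}$ is the $2\times2$ matrix defined in the context (with the given $\Psi$ and $r$). Then the method finds the minimizer of $f$ in at most $k_0+3$ iterations, i.e. $g_j=0$ for some $j\le k_0+3$.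
   Context: Admissible function: let $\lambda_1$ and $\lambda_n$ be the smallest and largest eigenvalues of $A$. $\Psi$ is a real analytic function on $[\lambda_1,\lambda_n]$ that can be expressed by a Laurent series $\Psi(z)=\sum_{j=-\infty}^{\infty}c_jz^j$, $c_j\in\mathbb{R}$, with $0<\Psi(z)<+\infty$ for all $z\in[\lambda_1,\lambda_n]$. Thus $\Psi(A)$ is symmetric positive definite, and for $r\in\mathbb{R}$, $\Psi^r(A)$ denotes the matrix power $(\Psi(A))^r$. Iterations: the iterates are $x_0,x_1,x_2,\dots$ with $x_0$ arbitrary. The formula $\alpha_k(\Psi(A))$ makes sense for $k\ge1$; the initial stepsize $\alpha_0>0$ is arbitrary. The method stops as soon as some $g_j=0$, i.e. $x_j$ is the minimizer. The vector $q_{k-1}$: for $k\ge 2$, $q_{k-1}\in\mathbb{R}^n$ denotes a vector satisfying $(I-\alpha_{k-2}A)q_{k-1}=g_{k-2}$. The matrix $H_k$: for $k\ge2$ and $r\in\mathbb{R}$, $$H_k=\begin{pmatrix}\dfrac{q_{k-1}^T\Psi^{2r}(A)Aq_{k-1}}{\|\Psi^r(A)q_{k-1}\|^2} & \dfrac{q_{k-1}^T\Psi(A)Ag_k}{\|\Psi^r(A)q_{k-1}\|\,\|\Psi^{1-r}(A)g_k\|}\\[2ex] \dfrac{q_{k-1}^T\Psi(A)Ag_k}{\|\Psi^r(A)q_{k-1}\|\,\|\Psi^{1-r}(A)g_k\|} & \dfrac{g_k^T\Psi^{2(1-r)}(A)Ag_k}{\|\Psi^{1-r}(A)g_k\|^2}\end{pmatrix},$$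 with entries denoted $H_k^{(ij)}$, and $\|\cdot\|$ the Euclidean norm. Standing assumption: if the method has not stopped by iteration $k_0$ (i.e. $g_j\ne0$ for all $j\le k_0$), then a vector $q_{k_0-1}\in\mathbb{R}^n$ satisfying $(I-\alpha_{k_0-2}A)q_{k_0-1}=g_{k_0-2}$ exists, and $\Psi^r(A)q_{k_0-1}$ and $\Psi^{1-r}(A)g_{k_0}$ are nonzero, so that $H_{k_0}$ is defined. *)

(* Defs.v *)
(* Mathematical Components, with MathComp-Analysis. *)
From HB Require Import structures.
From mathcomp Require Import all_boot all_order all_algebra.
From mathcomp Require Import all_classical all_reals all_analysis.
Set Implicit Arguments.
Unset Strict Implicit.
Unset Printing Implicit Defensive.
Import Order.TTheory GRing.Theory Num.Theory numFieldNormedType.Exports.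
Local Open Scope classical_set_scope.
Local Open Scope ring_scope.

Section Vectors.
Variables (R : realType) (n : nat).
Implicit Types (x y : 'cV[R]_n) (M : 'M[R]_n).

Definition bform M x y : R := (x^T *m M *m y) 0 0.

(* The Euclidean norm; the library norm on matrices is the sup norm. *)
Definition enorm x : R := Num.sqrt ((x^T *m x) 0 0).

Definition posdef M : Prop :=
  M \is symmetricmx /\ forall x, x != 0 -> 0 < bform M x x.

Definition gradient (f : 'cV[R]_n -> R) x : 'cV[R]_n :=
  \col_i 'D_(delta_mx i 0) f x.

Definition quadratic M (b x : 'cV[R]_n) : R :=
  2^-1 * bform M x x - (b^T *m x) 0 0.

Definition least_eigenvalue M (l : R) : Prop :=
  eigenvalue M l /\ forall a, eigenvalue M a -> l <= a.

Definition greatest_eigenvalue M (l : R) : Prop :=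
  eigenvalue M l /\ forall a, eigenvalue M a -> a <= l.

Definition orth_diag M (Qd : 'M[R]_n * 'rV[R]_n) : Prop :=
  Qd.1 *m Qd.1^T = 1%:M /\ M = Qd.1^T *m diag_mx Qd.2 *m Qd.1.

(* Real power of a symmetric positive definite matrix M = Q^T diag(d) Q, namely
   Q^T diag(d_i ^ r) Q; the result does not depend on the chosen Q and d. *)
Definition mxpowR M (r : R) : 'M[R]_n :=
  let Qd := xget (1%:M, 0) (orth_diag M) in
  Qd.1^T *m diag_mx (map_mx (fun a => a `^ r) Qd.2) *m Qd.1.

End Vectors.

Section Admissible.
Variable R : realType.

(* Doubly infinite series: the two halves j >= 0 and j < 0 are summed
   separately. *)
Definition bicvg (V : normedModType R) (u : int -> V) : Prop :=
  cvgn (series (fun m : nat => u m%:Z)) /\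
  cvgn (series (fun m : nat => u (- m.+1%:Z))).

Definition bisum (V : normedModType R) (u : int -> V) : V :=
  limn (series (fun m : nat => u m%:Z)) +
  limn (series (fun m : nat => u (- m.+1%:Z))).

(* f is, near each point of D, the restriction to D of the sum of a convergent
   power series (so that f extends analytically to a neighbourhood of D). *)
Definition real_analytic_on (D : set R) (f : R -> R) : Prop :=
  forall z, D z -> exists2 e : R, 0 < e &
    exists a : nat -> R, forall h, `|h| < e ->
      cvgn (pseries a h) /\ (D (z + h) -> f (z + h) = limn (pseries a h)).

Definition laurent_on (D : set R) (c : int -> R) (f : R -> R) : Prop :=
  forall z, D z -> bicvg (fun j : int => c j * z ^ j : R^o) /\
    f z = bisum (fun j : int => c j * z ^ j : R^o).

Definition admissible (lmin lmax : R) (c : int -> R) (Psi : R -> R) : Prop :=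
  [/\ real_analytic_on `[lmin, lmax] Psi,
      laurent_on `[lmin, lmax] c Psi &
      forall z, z \in `[lmin, lmax] -> 0 < Psi z].

(* Psi(A), for Psi given by its Laurent coefficients. *)
Definition laurent_mx n (c : int -> R) (A : 'M[R]_n.+1) : 'M[R]_n.+1 :=
  bisum (fun j : int => c j *: A ^ j).

End Admissible.

Section Stepsizes.
Variables (R : realType) (n : nat).
Implicit Types (A P : 'M[R]_n) (g q : 'cV[R]_n).

(* Below, P stands for Psi(A). *)
Definition stepsize A P g : R := bform P g g / bform (P *m A) g g.

Definition Hmx A P (r : R) q g : 'M[R]_2 :=
  let nq := enorm (mxpowR P r *m q) in
  let ng := enorm (mxpowR P (1 - r) *m g) in
  let h11 := bform (mxpowR P (2 * r) *m A) q q / nq ^+ 2 in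
  let h12 := bform (P *m A) q g / (nq * ng) in
  let h22 := bform (mxpowR P (2 * (1 - r)) *m A) g g / ng ^+ 2 in
  \matrix_(i, j) if i != j then h12 else if i == 0 then h11 else h22.

Definition alpha_tilde (H : 'M[R]_2) : R :=
  2 / ((H 0 0 + H 1 1)
       + Num.sqrt ((H 0 0 - H 1 1) ^+ 2 + 4 * H 0 1 ^+ 2)).

End Stepsizes.

(* Main.v *)
Require Import Defs.
From HB Require Import structures.
From mathcomp Require Import all_boot all_order all_algebra.
From mathcomp Require Import all_classical all_reals all_analysis.
From mathcomp Require Import ring lra zify.
Set Implicit Arguments.
Unset Strict Implicit.
Unset Printing Implicit Defensive.
Import Order.TTheory GRing.Theory Num.Theory numFieldNormedType.Exports.
Local Open Scope ring_scope.

(** Write P = Psi(A). It is positive definite and commutes with A, because A is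
    diagonalised by an orthogonal matrix and the Laurent series is summed
    eigenvalue by eigenvalue ([laurent_mx_spec]). As long as
    no gradient has vanished, g_(k+1) = (I - alpha_k A) g_k.

    The stepsize alpha_k is chosen so that g_(k-1) is P-orthogonal to
    (I - alpha_k A) g_(k-1) ([stepsize_orth]). Since
    (I - alpha_(k0-2) A) q = g_(k0-2), the symmetric factor
    I - alpha_(k0-2) A of g_k0 can be moved onto q, which turns this, for
    k = k0 - 1, into q^T P g_k0 = 0 ([bform_step]). Hence P^r q and P^(1-r) g_k0
    are orthogonal, and in dimension two they form, once normalised, an
    orthonormal basis. The matrix H_k0 is the matrix of A in that basis
    ([Hmx_similar]), so it has the eigenvalues l <= L of A and the special
    stepsize is exactly 1 / L ([alpha_tilde_similar]).

    The step of length 1 / L removes the L-component of the gradient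
    ([annihilating_step]): g_(k0+1) is an eigenvector for l, and g_(k0+2) is one
    too, whatever alpha_(k0+1) is. The stepsize alpha_(k0+2) is computed from the
    eigenvector g_(k0+1), so it equals 1 / l ([stepsize_eigen]), and
    g_(k0+3) = g_(k0+2) - g_(k0+2) = 0. *)

(** * Vectors and symmetric matrices *)

Section Vectors.
Variables (R : realType) (n : nat).
Implicit Types (M : 'M[R]_n) (x y : 'cV[R]_n).

Lemma col_neq0 x : x != 0 -> exists i, x i 0 != 0.
Proof.
move=> x0; apply/existsP; apply: contraR x0 => /existsPn x0.
by apply/eqP/colP => i; move: (x0 i); rewrite negbK mxE => /eqP.
Qed.

Lemma symmetricmxP M : reflect (M^T = M) (M \is symmetricmx).
Proof.
apply: (iffP (is_hermitianmxP _ _ _)).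
  by rewrite expr0 scale1r map_mx_id.
by move=> MT; rewrite expr0 scale1r map_mx_id.
Qed.

Lemma bformC M x y : M \is symmetricmx -> bform M x y = bform M y x.
Proof.
move=> /symmetricmxP MT.
by rewrite /bform -[in LHS](trmxK (_ *m y)) mxE !trmx_mul trmxK MT mulmxA.
Qed.

End Vectors.

(** * Spectral calculus *)

Section Spectral.
Variables (R : realType) (n : nat).
Implicit Types (Q M B : 'M[R]_n) (d e : 'rV[R]_n) (x : 'cV[R]_n).

Definition spec Q d : 'M[R]_n := Q^T *m diag_mx d *m Q.

Lemma spec_tr Q d : (spec Q d)^T = spec Q d.
Proof. by rewrite /spec !trmx_mul trmxK tr_diag_mx mulmxA. Qed.

Lemma specM Q d e : Q *m Q^T = 1%:M ->
  spec Q d *m spec Q e = spec Q (\row_i (d 0 i * e 0 i)).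
Proof.
move=> QQ; rewrite /spec -mulmx_diag !mulmxA -(mulmxA (Q^T *m diag_mx d) Q).
by rewrite QQ mulmx1.
Qed.

Lemma spec_const Q (a : R) : Q *m Q^T = 1%:M -> spec Q (const_mx a) = a%:M.
Proof.
move=> /mulmx1C QQ; rewrite /spec diag_const_mx mul_mx_scalar -scalemxAl QQ.
by rewrite scalemx1.
Qed.

Lemma specZ Q d (a : R) : spec Q (a *: d) = a *: spec Q d.
Proof.
rewrite /spec (_ : diag_mx (a *: d) = a *: diag_mx d); last by rewrite linearZ.
by rewrite -scalemxAr -scalemxAl.
Qed.

Lemma specB Q d e : spec Q (d - e) = spec Q d - spec Q e.
Proof. by rewrite /spec raddfB /= mulmxBr mulmxBl. Qed.

(** Linearity of [spec] in d as an explicit finite sum of fixed matrices: limits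
    of [spec Q d] then reduce to scalar limits. *)
Lemma specE Q d : spec Q d = \sum_i d 0 i *: spec Q (delta_mx 0 i).
Proof.
rewrite /spec diag_mx_sum_delta mulmx_sumr mulmx_suml; apply: eq_bigr => i _.
rewrite -scalemxAr -scalemxAl; congr (_ *: (_ *m _ *m _)).
rewrite diag_mx_sum_delta (bigD1 i) //= big1 ?addr0; last first.
  by move=> j ji; rewrite mxE (negbTE ji) andbF scale0r.
by rewrite mxE !eqxx scale1r.
Qed.

(** In the basis given by Q, commuting with diag(d) means that the (i, j) entry
    vanishes unless d_i = d_j, and then f(d_i) = f(d_j) as well. *)
Lemma spec_comm (f : R -> R) Q d B : Q *m Q^T = 1%:M ->
  B *m spec Q d = spec Q d *m B ->
  B *m spec Q (map_mx f d) = spec Q (map_mx f d) *m B.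
Proof.
move=> QQ; have QQ' := mulmx1C QQ.
have [C BE] : exists C, B = Q^T *m C *m Q.
  by exists (Q *m B *m Q^T); rewrite !mulmxA QQ' mul1mx -mulmxA QQ' mulmx1.
have conjM X Y : Q^T *m X *m Q *m (Q^T *m Y *m Q) = Q^T *m (X *m Y) *m Q.
  by rewrite !mulmxA -(mulmxA (Q^T *m X) Q) QQ mulmx1.
have conj_inj X Y : Q^T *m X *m Q = Q^T *m Y *m Q -> X = Y.
  move=> /(congr1 (fun Z => Q *m Z *m Q^T)).
  by rewrite !mulmxA QQ !mul1mx -!mulmxA QQ !mulmx1.
rewrite /spec BE !conjM => /conj_inj H; congr (_ *m _ *m _).
apply/matrixP => i j; move/matrixP/(_ i j): H.
rewrite !mul_mx_diag !mul_diag_mx !mxE => H.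
have [->|C0] := eqVneq (C i j) 0; first by rewrite mulr0 mul0r.
move: H; rewrite [RHS]mulrC => /(mulfI C0) ->.
by rewrite mulrC.
Qed.

Lemma bform_spec Q d x : bform (spec Q d) x x = \sum_i d 0 i * (Q *m x) i 0 ^+ 2.
Proof.
rewrite /bform /spec !mulmxA -(mulmxA _ Q x) -trmx_mul mxE.
by apply: eq_bigr => i _; rewrite mul_mx_diag !mxE; ring.
Qed.

Lemma posdef_spec Q d : Q *m Q^T = 1%:M ->
  posdef (spec Q d) <-> forall i, 0 < d 0 i.
Proof.
move=> QQ; have QQ' := mulmx1C QQ; split=> [[_ dpos] i|dpos].
  have := dpos (Q^T *m delta_mx i 0); rewrite bform_spec mulmxA QQ mul1mx.
  rewrite (bigD1 i) //= big1 => [|j ji]; last first.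
    by rewrite mxE (negbTE ji) expr0n mulr0.
  rewrite mxE !eqxx expr1n mulr1 addr0; apply; apply/eqP => /(congr1 (mulmx Q)).
  rewrite mulmxA QQ mul1mx mulmx0 => /matrixP/(_ i 0)/eqP.
  by rewrite !mxE !eqxx oner_eq0.
split=> [|x x0].
  by apply/symmetricmxP; rewrite spec_tr.
rewrite bform_spec; have [i Qx0] : exists i, (Q *m x) i 0 != 0.
  apply: col_neq0; apply: contraNneq x0 => Qx0.
  by rewrite -(mul1mx x) -QQ' -mulmxA Qx0 mulmx0.
rewrite (bigD1 i) //= ltr_wpDr //.
  by apply: sumr_ge0 => j _; rewrite mulr_ge0 ?sqr_ge0 // ltW.
by rewrite mulr_gt0 // exprn_even_gt0.
Qed.

Lemma eigenvalue_spec Q d i : Q *m Q^T = 1%:M -> eigenvalue (spec Q d) (d 0 i).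
Proof.
move=> QQ; apply/eigenvalueP; exists (row i Q).
  rewrite /spec -!row_mul !mulmxA QQ mul1mx mul_diag_mx.
  by apply/rowP => j; rewrite !mxE.
apply/eqP => Qi0; have := congr1 (fun M => M i i) QQ.
rewrite mxE big1 ?mxE ?eqxx => [/eqP|j _]; first by rewrite eq_sym oner_eq0.
by move/rowP/(_ j): Qi0; rewrite !mxE => ->; rewrite mul0r.
Qed.

(** All powers of M share one diagonalisation, with positive eigenvalues, so that
    the laws of real powers can be checked eigenvalue by eigenvalue. *)
Lemma mxpowR_spec M : posdef M -> (exists Qd, orth_diag M Qd) ->
  exists Q d, [/\ Q *m Q^T = 1%:M, forall i, 0 < d 0 i, M = spec Q d &
    forall r, mxpowR M r = spec Q (map_mx (fun a => a `^ r) d)].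
Proof.
move=> Mpos /(xgetPex (1%:M, 0)); rewrite /mxpowR.
case: (xget _ _) => Q d [/= QQ ME].
exists Q, d; split=> //.
by apply/(posdef_spec d QQ); rewrite /spec -ME.
Qed.

Lemma mxpowRD M r s : posdef M -> (exists Qd, orth_diag M Qd) ->
  mxpowR M r *m mxpowR M s = mxpowR M (r + s).
Proof.
move=> Mpos /(mxpowR_spec Mpos)[Q [d [QQ dpos _ powE]]].
rewrite !powE specM //; congr (spec _ _); apply/rowP => i; rewrite !mxE powRD //.
by rewrite (gt_eqF (dpos i)) implybT.
Qed.

Lemma mxpowR1 M : posdef M -> (exists Qd, orth_diag M Qd) -> mxpowR M 1 = M.
Proof.
move=> Mpos /(mxpowR_spec Mpos)[Q [d [QQ dpos ME ->]]].
by rewrite ME; congr spec; apply/rowP => i; rewrite mxE powRr1 // ltW.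
Qed.

Lemma mxpowR_tr M r : (mxpowR M r)^T = mxpowR M r.
Proof. exact: spec_tr. Qed.

Lemma mxpowR_comm M B r : posdef M -> (exists Qd, orth_diag M Qd) ->
  B *m M = M *m B -> B *m mxpowR M r = mxpowR M r *m B.
Proof.
move=> Mpos /(mxpowR_spec Mpos)[Q [d [QQ dpos ME ->]]] BM.
by apply: spec_comm => //; rewrite -ME.
Qed.

End Spectral.

(** * Matrix Laurent series *)

Section Laurent.
Variables (R : realType) (n : nat).
Implicit Types (Q : 'M[R]_n.+1) (d : 'rV[R]_n.+1).

Lemma specXz Q d (j : int) : Q *m Q^T = 1%:M -> (forall i, d 0 i != 0) ->
  spec Q d ^ j = spec Q (map_mx (fun a => a ^ j) d).
Proof.
move=> QQ d0.
have posE (e : 'rV[R]_n.+1) m :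
    spec Q e ^+ m = spec Q (map_mx (fun a => a ^+ m) e).
  elim: m => [|m IH].
    rewrite expr0 -[LHS]/(1%:M) -(spec_const 1 QQ); congr spec.
    by apply/rowP => i; rewrite !mxE.
  rewrite exprS IH -[LHS]/(_ *m _) specM //; congr spec; apply/rowP => i.
  by rewrite !mxE exprS.
have invE m : spec Q (map_mx (fun a => a ^- m) d) * spec Q d ^+ m = 1.
  rewrite posE -[LHS]/(_ *m _) specM // -[RHS]/(1%:M) -(spec_const 1 QQ); congr spec.
  by apply/rowP => i; rewrite !mxE mulVf // expf_neq0.
case: j => m; first exact: posE.
rewrite NegzE -exprnN.
have [_ U] := mulmx1_unit (invE m.+1).
by rewrite -[LHS]mul1r -(invE m.+1) mulrK.
Qed.

Lemma cvgn_series_spec Q (u : 'I_n.+1 -> nat -> R) :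
  (forall i, cvgn (series (u i) : nat -> R^o)) ->
  (series (fun m => spec Q (\row_i u i m)) @ \oo -->
     spec Q (\row_i limn (series (u i) : nat -> R^o)))%classic.
Proof.
move=> ucv; rewrite [spec Q (\row_i limn _)]specE.
rewrite (_ : series _ = fun m => \sum_i series (u i) m *: spec Q (delta_mx 0 i)).
  apply: cvg_big; first exact: add_continuous.
  by move=> i _; rewrite mxE; apply: cvgZr_tmp; exact: ucv.
apply/funext => m; rewrite /series /=.
under eq_bigr do rewrite specE.
rewrite exchange_big /=; apply: eq_bigr => i _; rewrite scaler_suml.
by apply: eq_bigr => k _; rewrite mxE.
Qed.

(** The two half-series are summed eigenvalue by eigenvalue; they converge because
    the scalar series does at every eigenvalue. *)
Lemma laurent_mx_spec Q d (c : int -> R) (Psi : R -> R) (D : set R) :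
  Q *m Q^T = 1%:M -> (forall i, d 0 i != 0) -> (forall i, D (d 0 i)) ->
  laurent_on D c Psi -> laurent_mx c (spec Q d) = spec Q (map_mx Psi d).
Proof.
move=> QQ d0 dD PsiE.
have half (h : nat -> int) :
    (forall i, cvgn (series (fun m => c (h m) * d 0 i ^ h m : R^o))) ->
    limn (series (fun m => c (h m) *: spec Q d ^ h m)) =
    spec Q (\row_i limn (series (fun m => c (h m) * d 0 i ^ h m : R^o))).
  move=> /(@cvgn_series_spec Q _) /(cvg_lim (@norm_hausdorff _ _)) <-.
  congr (limn (series _)); apply/funext => m; rewrite specXz // [in LHS]specE.
  rewrite [RHS]specE scaler_sumr; apply: eq_bigr => i _.
  by rewrite !mxE scalerA.
rewrite /laurent_mx /bisum (half (fun m => m%:Z)); last first.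
  by move=> i; have [[]] := PsiE _ (dD i).
rewrite (half (fun m => - m.+1%:Z)); last by move=> i; have [[]] := PsiE _ (dD i).
rewrite /spec -mulmxDl -mulmxDr -raddfD/=; congr (_ *m diag_mx _ *m _).
by apply/rowP => i; rewrite !mxE; have [_ ->] := PsiE _ (dD i).
Qed.

End Laurent.

(** * The gradient of a quadratic *)

Section Gradient.
Variables (R : realType) (n : nat).
Implicit Types (M : 'M[R]_n) (b x : 'cV[R]_n).

(** Along the line x + h v the difference quotient is affine in h, so the
    directional derivative can be read off at h = 0. *)
Lemma gradient_quadratic M b x : M \is symmetricmx ->
  gradient (quadratic M b) x = M *m x - b.
Proof.
move=> Msym; apply/colP => i; rewrite mxE; set v := delta_mx i 0.
have -> : (M *m x - b) i 0 = bform M v x - (b^T *m v) 0 0.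
  by rewrite /bform -mulmxA /v trmx_delta -rowE -colE !mxE.
apply: cvg_lim => //; set a := _ - _; set k := 2^-1 * bform M v v.
have lin : ((fun h : R => a + h * k) @ 0^' --> a)%classic.
  rewrite -[X in (_ --> X)%classic]addr0; apply: cvgD; first exact: cvg_cst.
  rewrite -[X in (_ --> X)%classic](mul0r k).
  have id0 : ((fun h : R => h) @ 0^' --> (0 : R))%classic by exact: cvg_within.
  exact: cvgMr_tmp id0.
apply: cvg_trans lin; apply: near_eq_cvg.
near=> h; have h0 : h != 0 by near: h; exact: nbhs_dnbhs_neq.
rewrite /quadratic /=.
have -> : bform M (h *: v + x) (h *: v + x) =
    h ^+ 2 * bform M v v + 2 * h * bform M v x + bform M x x.
  have vx := bformC v x Msym; move: vx; rewrite /bform => vx.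
  rewrite (_ : (h *: v + x)^T = h *: v^T + x^T); last by rewrite linearD linearZ.
  rewrite !mulmxDl !mulmxDr.
  rewrite -!scalemxAl -!scalemxAr !mxE; rewrite !mxE in vx.
  rewrite -vx; ring.
have -> : (b^T *m (h *: v + x)) 0 0 = h * (b^T *m v) 0 0 + (b^T *m x) 0 0.
  by rewrite mulmxDr -scalemxAr !mxE.
by rewrite /a /k /GRing.scale /=; field.
Unshelve. all: by end_near.
Qed.

End Gradient.

(** * Dimension two: the special stepsize *)

Section Plane.
Variable R : realType.
Implicit Types (A P H U : 'M[R]_2) (q g : 'cV[R]_2).

(** In the plane one unit eigenvector (a, b) suffices: by symmetry (-b, a) is an
    eigenvector too, and its eigenvalue is tr A - l. *)
Lemma symmetric2_orth_diag A (l : R) : A \is symmetricmx -> eigenvalue A l ->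
  exists Qd, orth_diag A Qd.
Proof.
move=> /symmetricmxP AT.
have A10 : A 1 0 = A 0 1 by rewrite -{1}AT mxE.
case/eigenvalueP => v vA v0.
pose s := v 0 0 ^+ 2 + v 0 1 ^+ 2.
have s0 : 0 < s.
  rewrite lt0r addr_ge0 ?sqr_ge0 // andbT paddr_eq0 ?sqr_ge0 // !sqrf_eq0.
  apply: contraNN v0 => /andP[/eqP v00 /eqP v01]; apply/eqP/rowP => i.
  case: (unliftP 0 i) => [j|] ->; rewrite ?ord1 mxE // ?v00 // -v01.
  by congr (v _ _); apply/val_inj.
pose t := Num.sqrt s; have t0 : t != 0 by rewrite gt_eqF // sqrtr_gt0.
have t2 : t ^+ 2 = s by rewrite sqr_sqrtr // ltW.
pose a := v 0 0 / t; pose b := v 0 1 / t.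
have ab : a * a + b * b = 1.
  have -> : a * a + b * b = s / t ^+ 2 by rewrite /a /b /s; field.
  by rewrite t2 divff // gt_eqF.
have e0 : a * A 0 0 + b * A 0 1 = l * a.
  have /rowP/(_ 0) := vA; rewrite !mxE big_ord_recl big_ord1 /=.
  rewrite (_ : lift 0 0 = 1) ?A10; last exact/val_inj.
  by rewrite /a /b => H; rewrite mulrA -H; field.
have e1 : a * A 0 1 + b * A 1 1 = l * b.
  have /rowP/(_ 1) := vA; rewrite !mxE big_ord_recl big_ord1 /=.
  rewrite (_ : lift 0 0 = 1); last exact/val_inj.
  by rewrite /a /b => H; rewrite mulrA -H; field.
pose Q : 'M[R]_2 := \matrix_(i, j)
  if i == 0 then (if j == 0 then a else b) else (if j == 0 then - b else a).
pose d : 'rV[R]_2 := \row_i if i == 0 then l else A 0 0 + A 1 1 - l.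
have QQ : Q *m Q^T = 1%:M.
  apply/matrixP => i j; rewrite !mxE big_ord_recl big_ord1 !mxE /=.
  case: (unliftP 0 i) => [i'|] ->; case: (unliftP 0 j) => [j'|] ->;
  rewrite ?ord1 /=; lra.
exists (Q, d); split => //=.
suff QA : Q *m A = diag_mx d *m Q.
  by rewrite -mulmxA -QA mulmxA (mulmx1C QQ) mul1mx.
have l1 : lift 0 (0 : 'I_1) = 1 :> 'I_2 by exact/val_inj.
rewrite mul_diag_mx; apply/matrixP => i j.
rewrite !mxE big_ord_recl big_ord1 !mxE /= l1.
case: (unliftP 0 i) => [i'|] ->; case: (unliftP 0 j) => [j'|] ->;
  rewrite ?ord1 /= ?l1 ?A10; nra.
Qed.

(** Trace and determinant are similarity invariants, so the discriminant under
    the square root is (L - l)^2 and the denominator is 2 L. *)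
Lemma alpha_tilde_similar H U A (l L : R) : 0 < l -> l <= L ->
  A \is symmetricmx -> U^T *m U = 1%:M -> H = U^T *m A *m U ->
  \tr A = l + L -> \det A = l * L -> alpha_tilde H = L^-1.
Proof.
move=> l0 lL /symmetricmxP AT UU HE trA detA.
have HT : H^T = H by rewrite HE !trmx_mul trmxK AT mulmxA.
have trH : H 0 0 + H 1 1 = l + L.
  rewrite -trA -[A]mulmx1 -(mulmx1C UU) mulmxA mxtrace_mulC mulmxA -HE.
  rewrite /mxtrace big_ord_recl big_ord1; congr (_ + H _ _); exact/val_inj.
have detH : H 0 0 * H 1 1 - H 0 1 ^+ 2 = l * L.
  have : \det H = l * L.
    by rewrite HE !det_mulmx mulrAC -det_mulmx UU det1 mul1r.
  rewrite (expand_det_row _ 0) big_ord_recl big_ord1 /cofactor !det_mx11 !mxE /=.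
  have l1 : lift 0 (0 : 'I_1) = 1 :> 'I_2 by exact/val_inj.
  have l2 : lift 1 (0 : 'I_1) = 0 :> 'I_2 by exact/val_inj.
  have H10 : H 1 0 = H 0 1 by rewrite -[in LHS]HT mxE.
  by rewrite !l1 !l2 H10 => <-; rewrite /=; ring.
rewrite /alpha_tilde.
have -> : (H 0 0 - H 1 1) ^+ 2 + 4 * H 0 1 ^+ 2 = (L - l) ^+ 2.
  have -> : H 0 1 ^+ 2 = H 0 0 * H 1 1 - l * L by rewrite -detH; ring.
  have -> : H 1 1 = l + L - H 0 0 by rewrite -trH; ring.
  ring.
rewrite sqrtr_sqr ger0_norm ?subr_ge0 // trH.
have L0 : L != 0 by rewrite gt_eqF // (lt_le_trans l0).
field; rewrite L0 /=; apply/eqP; lra.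
Qed.

(** The columns of U are P^r q and P^(1-r) g, normalised; they are orthogonal
    because P^r P^(1-r) = P and q^T P g = 0. As A commutes with the powers of P,
    the bilinear forms in the entries of [Hmx] are those of A on these columns. *)
Lemma Hmx_similar A P (r : R) q g : A \is symmetricmx ->
  posdef P -> (exists Qd, orth_diag P Qd) -> A *m P = P *m A ->
  mxpowR P r *m q != 0 -> mxpowR P (1 - r) *m g != 0 -> bform P q g = 0 ->
  exists2 U, U^T *m U = 1%:M & Hmx A P r q g = U^T *m A *m U.
Proof.
move=> Asym Ppos Pd AP; rewrite /Hmx.
have -> : mxpowR P (2 * r) = mxpowR P r *m mxpowR P r.
  by rewrite mxpowRD //; congr mxpowR; ring.
have -> : mxpowR P (2 * (1 - r)) = mxpowR P (1 - r) *m mxpowR P (1 - r).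
  by rewrite mxpowRD //; congr mxpowR; ring.
have ST : mxpowR P r *m mxpowR P (1 - r) = P.
  by rewrite mxpowRD // addrC subrK mxpowR1.
have Str := mxpowR_tr P r; have Ttr := mxpowR_tr P (1 - r).
have AS := mxpowR_comm r Ppos Pd AP; have AT := mxpowR_comm (1 - r) Ppos Pd AP.
(* Only these identities on the powers of P matter from here on. *)
move: (mxpowR P r) (mxpowR P (1 - r)) ST Str Ttr AS AT => S T ST Str Ttr AS AT.
set u := S *m q; set w := T *m g => u0 w0 qg.
have dot_gt0 (y : 'cV[R]_2) : y != 0 -> 0 < (y^T *m y) 0 0.
  move=> /col_neq0[i yi].
  rewrite mxE (bigD1 i) //= mxE -expr2 ltr_wpDr ?exprn_even_gt0 //.
  by apply: sumr_ge0 => j _; rewrite mxE -expr2 sqr_ge0.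
have norm2 (y : 'cV[R]_2) : y != 0 -> enorm y ^+ 2 = (y^T *m y) 0 0.
  by move=> y0; rewrite sqr_sqrtr // ltW // dot_gt0.
have norm0 (y : 'cV[R]_2) : y != 0 -> enorm y != 0.
  by move=> y0; rewrite gt_eqF // sqrtr_gt0 dot_gt0.
have uw : u^T *m w = 0.
  apply/matrixP => i j; rewrite !ord1 [RHS]mxE -[RHS]qg /bform -ST /u /w.
  by rewrite trmx_mul Str !mulmxA.
have h11 : bform (S *m S *m A) q q = bform A u u.
  by rewrite /bform /u trmx_mul Str -!mulmxA (mulmxA A) AS -!mulmxA.
have h22 : bform (T *m T *m A) g g = bform A w w.
  by rewrite /bform /w trmx_mul Ttr -!mulmxA (mulmxA A) AT -!mulmxA.
have h12 : bform (P *m A) q g = bform A u w.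
  by rewrite /bform /u /w trmx_mul Str -ST -!mulmxA (mulmxA A) AT -!mulmxA.
rewrite h11 h12 h22.
pose z : 'I_2 -> 'cV[R]_2 := fun j =>
  if j == 0 then (enorm u)^-1 *: u else (enorm w)^-1 *: w.
pose U : 'M[R]_2 := \matrix_(i, j) z j i 0.
have congE (B : 'M[R]_2) i j : (U^T *m B *m U) i j = bform B (z i) (z j).
  rewrite /bform !mxE; apply: eq_bigr => k _; rewrite !mxE; congr (_ * _).
  by apply: eq_bigr => m _; rewrite !mxE.
have bZ (B : 'M[R]_2) s t (y y' : 'cV[R]_2) :
    bform B (s *: y) (t *: y') = s * t * bform B y y'.
  rewrite /bform (_ : (s *: y)^T = s *: y^T); last by rewrite linearZ.
  by rewrite -!scalemxAl -scalemxAr scalerA mxE mulrC (mulrC s).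
have b1 (y y' : 'cV[R]_2) : bform 1%:M y y' = (y^T *m y') 0 0.
  by rewrite /bform mulmx1.
exists U.
  rewrite -[U^T]mulmx1; apply/matrixP => i j; rewrite congE mxE /z.
  case: (unliftP 0 i) => [i'|] ->; case: (unliftP 0 j) => [j'|] ->;
    rewrite ?ord1 /= bZ b1 /=.
  - by rewrite -norm2 //; field; exact: norm0.
  - by rewrite -[w^T *m u]trmxK trmx_mul trmxK uw trmx0 mxE mulr0.
  - by rewrite uw mxE mulr0.
  - by rewrite -norm2 //; field; exact: norm0.
apply/matrixP => i j; rewrite congE mxE /z.
case: (unliftP 0 i) => [i'|] ->; case: (unliftP 0 j) => [j'|] ->;
  rewrite ?ord1 /= bZ //.
- by field; exact: norm0.
- by rewrite (bformC w u) //; field; rewrite !norm0.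
- by field; rewrite !norm0.
- by field; exact: norm0.
Qed.

End Plane.

(** * Gradient steps *)

Section Steps.
Variables (R : realType) (n : nat).
Implicit Types (A P Q : 'M[R]_n) (q g y : 'cV[R]_n).

Lemma bformZr P a q g : bform P q (a *: g) = a * bform P q g.
Proof. by rewrite /bform -scalemxAr mxE. Qed.

(** I - a A is symmetric and commutes with P, so it moves from one argument of
    the form to the other. *)
Lemma bform_step A P a q y : A \is symmetricmx -> A *m P = P *m A ->
  bform P q (y - a *: (A *m y)) = bform P (q - a *: (A *m q)) y.
Proof.
move=> /symmetricmxP AT AP.
rewrite /bform (_ : (q - _)^T = q^T - a *: (q^T *m A)); last first.
  by rewrite -[in RHS]AT -trmx_mul linearB /= linearZ.
rewrite mulmxBr !mulmxBl -!scalemxAr -!scalemxAl.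
by rewrite -(mulmxA q^T A P) AP !mulmxA.
Qed.

(** Both sides are (I - a A)(I - a' A) y. *)
Lemma stepsC A a a' y :
  (y - a *: (A *m y)) - a' *: (A *m (y - a *: (A *m y))) =
  (y - a' *: (A *m y)) - a *: (A *m (y - a' *: (A *m y))).
Proof.
rewrite !mulmxBr -!scalemxAr !scalerBr !scalerA (mulrC a') !opprB.
by rewrite addrACA [RHS]addrACA; congr (_ + _); rewrite addrC.
Qed.

Lemma stepsize_orth A P g : bform (P *m A) g g != 0 ->
  bform P g (g - stepsize A P g *: (A *m g)) = 0.
Proof.
move=> PA0; rewrite /bform mulmxBr mxE [X in _ + X]mxE -/(bform P g g).
rewrite -/(bform P g (stepsize A P g *: (A *m g))) bformZr.
rewrite -[bform P g (A *m g)]/((g^T *m P *m (A *m g)) 0 0) mulmxA -(mulmxA _ P).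
by rewrite -/(bform (P *m A) g g) divfK // subrr.
Qed.

Lemma stepsize_eigen A P l g : bform P g g != 0 -> A *m g = l *: g ->
  stepsize A P g = l^-1.
Proof.
move=> Pg0 Ag; rewrite /stepsize.
have -> : bform (P *m A) g g = l * bform P g g.
  by rewrite -bformZr -Ag /bform !mulmxA.
by rewrite invfM mulrCA divff // mulr1.
Qed.

Lemma eigen_step A l a g : A *m g = l *: g ->
  A *m (g - a *: (A *m g)) = l *: (g - a *: (A *m g)).
Proof.
move=> Ag; rewrite mulmxBr -scalemxAr Ag -scalemxAr Ag scalerBr !scalerA.
by congr (_ - _ *: _); ring.
Qed.

(** The range of I - A / L lies in the eigenspace for l: on each eigenvector
    either the factor I - A / L vanishes or the eigenvalue is l. *)
Lemma annihilating_step Q (d : 'rV[R]_n) (l L : R) y : Q *m Q^T = 1%:M ->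
  (forall i, d 0 i = l \/ d 0 i = L) -> L != 0 ->
  spec Q d *m (y - L^-1 *: (spec Q d *m y)) =
  l *: (y - L^-1 *: (spec Q d *m y)).
Proof.
move=> QQ dlL L0.
have -> : y - L^-1 *: (spec Q d *m y) = spec Q (const_mx 1 - L^-1 *: d) *m y.
  by rewrite specB specZ spec_const // mulmxBl mul1mx scalemxAl.
rewrite mulmxA scalemxAl specM // -specZ; congr (spec _ _ *m _).
apply/rowP => i; rewrite !mxE.
by case: (dlL i) => -> //; rewrite mulVf // subrr !mulr0.
Qed.

End Steps.

(** * Finite termination *)

Theorem theorem1 (R : realType) (A : 'M[R]_2) (b : 'cV[R]_2)
    (lmin lmax : R) (c : int -> R) (Psi : R -> R) (k0 : nat) (r : R)
    (x g : nat -> 'cV[R]_2) (alpha : nat -> R) (q : 'cV[R]_2)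
    (A_posdef : posdef A)
    (lminP : least_eigenvalue A lmin)
    (lmaxP : greatest_eigenvalue A lmax)
    (Psi_adm : admissible lmin lmax c Psi)
    (k0_ge2 : (2 <= k0)%N)
    (gE : forall k, g k = gradient (quadratic A b) (x k))
    (xE : forall k, (forall j, (j <= k)%N -> g j != 0) ->
       x k.+1 = x k - alpha k *: g k)
    (alpha0_gt0 : 0 < alpha 0%N)
    (alphaE : forall k, (1 <= k)%N -> k != k0 ->
       (forall j, (j <= k)%N -> g j != 0) ->
       alpha k = stepsize A (laurent_mx c A) (g k.-1))
    (* q plays the role of q_{k0 - 1} *)
    (alpha_k0E : (forall j, (j <= k0)%N -> g j != 0) ->
       [/\ (1%:M - alpha (k0 - 2)%N *: A) *m q = g (k0 - 2)%N,
           mxpowR (laurent_mx c A) r *m q != 0,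
           mxpowR (laurent_mx c A) (1 - r) *m g k0 != 0 &
           alpha k0 = alpha_tilde (Hmx A (laurent_mx c A) r q (g k0))]) :
  exists2 j, (j <= k0 + 3)%N & g j = 0.
Proof.
have [//|nostop] := pselect (exists2 j, (j <= k0 + 3)%N & g j = 0).
have gN0 j : (j <= k0 + 3)%N -> g j != 0.
  by move=> jk; apply/eqP => gj; apply: nostop; exists j.
have Asym := A_posdef.1.
have [[Q d] [/= QQ AE]] := symmetric2_orth_diag Asym lminP.1.
rewrite -[RHS]/(spec Q d) in AE.
have dpos : forall i, 0 < d 0 i by apply/(posdef_spec d QQ); rewrite -AE.
have d_in i : d 0 i \in `[lmin, lmax].
  have := eigenvalue_spec d i QQ; rewrite -AE => ev.
  by rewrite in_itv /= lminP.2 ?lmaxP.2.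
have [_ Psi_laurent Psi_gt0] := Psi_adm.
have PE : laurent_mx c A = spec Q (map_mx Psi d).
  rewrite AE; apply: laurent_mx_spec Psi_laurent => // i.
  by rewrite gt_eqF.
set P := laurent_mx c A in PE alphaE alpha_k0E.
have Ppos : posdef P.
  by rewrite PE; apply/posdef_spec => // i; rewrite mxE Psi_gt0.
have Pdiag : exists Qd, orth_diag P Qd by exists (Q, map_mx Psi d).
have AP : A *m P = P *m A by rewrite PE AE; exact: spec_comm.
have PApos : posdef (P *m A).
  rewrite PE AE specM //; apply/posdef_spec => // i.
  by rewrite !mxE mulr_gt0 // Psi_gt0.
pose l := Num.min (d 0 0) (d 0 1); pose L := Num.max (d 0 0) (d 0 1).
have dlL i : d 0 i = l \/ d 0 i = L.
  have : d 0 i = d 0 0 \/ d 0 i = d 0 1.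
    case: (unliftP 0 i) => [j|] ->; [right|by left].
    by rewrite ord1; congr (d _ _); exact/val_inj.
  by rewrite /l /L; case: leP => _ [] ->; auto.
have l0 : 0 < l by rewrite lt_min !dpos.
have lL : l <= L by rewrite ge_min le_max lexx.
have L0 : 0 < L by exact: lt_le_trans lL.
have trA : \tr A = l + L.
  rewrite AE /spec mxtrace_mulC mulmxA QQ mul1mx mxtrace_diag big_ord_recl big_ord1.
  by rewrite addr_min_max; congr (_ + d _ _); exact/val_inj.
have detA : \det A = l * L.
  rewrite AE /spec !det_mulmx mulrAC -det_mulmx (mulmx1C QQ) det1 mul1r det_diag.
  rewrite big_ord_recl big_ord1 /l /L.
  rewrite (_ : lift 0 0 = 1); last exact/val_inj.
  by case: leP => _ //; rewrite mulrC.
have gS k : (k <= k0 + 3)%N -> g k.+1 = g k - alpha k *: (A *m g k).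
  move=> kk; have xk : x k.+1 = x k - alpha k *: g k.
    by apply: xE => j jk; apply: gN0; exact: leq_trans kk.
  rewrite (gE k.+1) {1}(gE k) !gradient_quadratic // xk mulmxBr -scalemxAr.
  by rewrite addrAC.
case: k0 k0_ge2 => [|[|k]] // _ in gN0 gS alphaE alpha_k0E nostop *.
rewrite !subn2 /= in alpha_k0E.
have g1 : g k.+3 != 0 by apply: gN0; lia.
have [|qE u0 w0 alphaK] := alpha_k0E.
  by move=> j jk; apply: gN0; rewrite (leq_trans jk) // leq_addr.
have alpha1 : alpha k.+1 = stepsize A P (g k).
  apply: alphaE => //; first by rewrite neq_ltn ltnSn.
  by move=> j jk; apply: gN0; lia.
have qg : bform P q (g k.+2) = 0.
  (* The two steps are swapped, so that the factor I - alpha_k A is outermost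
     and can be moved onto q, where it gives g k. *)
  have gk2 : g k.+2 = g k - alpha k.+1 *: (A *m g k) -
      alpha k *: (A *m (g k - alpha k.+1 *: (A *m g k))).
    have [? ?] : (k <= k.+2 + 3)%N /\ (k.+1 <= k.+2 + 3)%N by lia.
    by rewrite (gS k.+1) // (gS k) //; exact: stepsC.
  rewrite gk2 bform_step // (_ : q - _ = g k).
    rewrite alpha1 stepsize_orth // gt_eqF // PApos.2 // gN0 //.
    by rewrite -addn2 -addnA leq_addr.
  by rewrite -qE mulmxBl mul1mx scalemxAl.
have [U UU HE] := Hmx_similar Asym Ppos Pdiag AP u0 w0 qg.
rewrite (alpha_tilde_similar l0 lL Asym UU HE trA detA) in alphaK.
have eig1 : A *m g k.+3 = l *: g k.+3.
  rewrite gS ?alphaK; last by lia.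
  by rewrite AE; apply: annihilating_step => //; rewrite gt_eqF.
have eig2 : A *m g k.+4 = l *: g k.+4.
  rewrite (gS k.+3); last by lia.
  exact: eigen_step.
have alpha4 : alpha k.+4 = l^-1.
  rewrite alphaE //; last 2 first.
  - by rewrite neq_ltn !ltnS !leqnSn orbT.
  - by move=> j jk; apply: gN0; lia.
  by apply: stepsize_eigen eig1; rewrite gt_eqF // Ppos.2.
exists k.+4.+1; first by lia.
rewrite gS ?eig2 ?alpha4; last by lia.
by rewrite scalerA mulVf ?gt_eqF // scale1r subrr.
Qed.
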